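(* Consider the Beckmann model with BPR cost functions, let $t^*$ be a minimizer of $Q$ over $t\ge\bar t$ and $R=\|t^*-\bar t\|_2$. Let $\varepsilon>0$ and let the universal gradient method (UGM) be run with accuracy $\varepsilon$ and initial parameter $0<L_0\le\frac{M^2}{\varepsilon}$, producing $\hat t^N,\hat f^N$. Then after at most $$N_Q=2\left(\frac{RM}{\varepsilon}\right)^2$$ iterations of UGM it holds that $Q(\hat t^N)-Q(t^* )\le\varepsilon$. Moreover, the stopping criterion $$Q(\hat t^N)+\Psi(\hat f^N)\le\varepsilon$$ is fulfilled after at most $$N_{stop}=2\left(\frac{\tilde RM}{\varepsilon}\right)^2$$ iterations, where $$\tilde R^2=\rho^2\sum_{e\in E}\frac{\bar t_e^2}{\bar f_e^{2/\mu}}\left(\sum_{w\in OD}d_w\right)^{2/\mu}.$$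
   Context: Network. $G=(V,E)$ is a finite directed graph. $OD$ is a finite set of origin-destination pairs $w=(i,j)$ of vertices, with demands $d_w\ge 0$. $P_w$ is the (nonempty) set of simple paths from $i$ to $j$ for $w=(i,j)$, and $P=\bigcup_{w\in OD}P_w$. $X=\{x\in\mathbb R_+^{|P|}:\sum_{p\in P_w}x_p=d_w,\ w\in OD\}$. $\Theta$ is the $|E|\times|P|$ matrix with $\Theta_{e,p}=1$ if $e\in p$ and $0$ otherwise. Each edge $e$ has free flow time $\bar t_e>0$ and capacity $\bar f_e>0$. For $t\in\mathbb R_+^{|E|}$: $T_p(t)=\sum_{e\in p}t_e$, $T_w(t)=\min_{p\in P_w}T_p(t)$. Vector inequalities are componentwise. Beckmann model. With parameters $\rho>0$, $\mu>0$, the cost functions are $\tau_e(f_e)=\bar t_e\bigl(1+\rho(f_e/\bar f_e)^{1/\mu}\bigr)$ for $f_e\ge0$. The primal objective is $\Psi(f)=\sum_{e\in E}\int_0^{f_e}\tau_e(z)\,dz$, to be minimized over $f\in\{\Theta x:x\in X\}$. The dual problem is to minimize over $t\ge\bar t$ the function $Q(t)=\Phi(t)+h(t)$, where $\Phi(t)=-\sum_{w\in OD}d_wT_w(t)$ and $h(t)=\sum_{e\in E}\bar f_e\left(\frac{t_e-\bar t_e}{\bar t_e\rho}\right)^{\mu}\frac{t_e-\bar t_e}{1+\mu}$ with $\operatorname{dom}h=\{t:t\ge\bar t\}$. Subgradients. $\partial\Phi(t)=-\sum_{w\in OD}d_w\,\mathrm{Conv}\{a_p:p\in P_w,\ T_p(t)=T_w(t)\}$,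 where $a_p\in\{0,1\}^{|E|}$ is the indicator vector of the edges of $p$. $\nabla\Phi(t)$ denotes an arbitrary (chosen) element of $\partial\Phi(t)$. Constant $M$. $M=\sqrt{2H}\sum_{w\in OD}d_w$, where $H$ is the diameter of $G$; $M$ comes with the bound $\|\nabla\Phi(t_1)-\nabla\Phi(t_2)\|_2\le M$ for all $t_1,t_2\in\mathbb R_+^{|E|}$ and all choices of subgradients. UGM. Input $L_0>0$, $\varepsilon>0$. Set $t^0=\bar t$. For $k=0,1,2,\dots$: set $L_{k+1}:=L_k/2$; repeat: compute $t^{k+1}:=\arg\min_{t\in\operatorname{dom}h}\{\langle\nabla\Phi(t^k),t-t^k\rangle+h(t)+\frac{L_{k+1}}2\|t-t^k\|_2^2\}$; if $\Phi(t^{k+1})\le\Phi(t^k)+\langle\nabla\Phi(t^k),t^{k+1}-t^k\rangle+\frac{L_{k+1}}2\|t^{k+1}-t^k\|_2^2+\frac\varepsilon2$, accept $L_{k+1},t^{k+1}$ and go to the next $k$; otherwise replace $L_{k+1}$ by $2L_{k+1}$ and repeat. ''Iterations'' counts the outer index $k$. After $N\ge1$ iterations, $$S_N=\sum_{k=1}^N\frac1{L_k},\quad \hat t^N=\frac1{S_N}\sum_{k=1}^N\frac{t^k}{L_k},\quad \hat f^N=-\frac1{S_N}\sum_{k=0}^{N-1}\frac{\nabla\Phi(t^k)}{L_{k+1}}.$$ Convention: a property ''holds after at most $K$ iterations'' means that it holds for some integer $N$ with $1\le N\le\max\{1,\lceil K\rceil\}$. *)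

(* Defs.v *)
From HB Require Import structures.
From mathcomp Require Import all_boot all_order all_algebra.
From mathcomp Require Import all_classical all_reals all_analysis.

Set Implicit Arguments.
Unset Strict Implicit.
Unset Printing Implicit Defensive.

Import Order.TTheory GRing.Theory Num.Theory.
Local Open Scope classical_set_scope.
Local Open Scope ring_scope.

Record digraph := Digraph {
  vertex : finType;
  edge : finType;
  source : edge -> vertex;
  target : edge -> vertex }.

Fixpoint walk (G : digraph) (i : vertex G) (p : seq (edge G)) (j : vertex G)
    : bool :=
  if p is e :: p' then (source e == i) && walk (target e) p' j else i == j.

(* No vertex is visited twice. *)
Definition simple_path (G : digraph) (i : vertex G) (p : seq (edge G))
    (j : vertex G) : bool :=
  walk i p j && uniq (i :: [seq target e | e <- p]).

(* A simple path has fewer than #|V| edges, so bounding the length by #|V|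
   loses nothing and makes the type of candidate paths finite. *)
Definition route (G : digraph) : finType := #|vertex G|.-bseq (edge G).

(* The set P_w. *)
Definition routes (G : digraph) (w : vertex G * vertex G) : {set route G} :=
  [set p : route G | simple_path w.1 p w.2]%SET.

(* The default #|V| exceeds the length of every simple path, hence it only
   matters when there is no path. *)
Definition distance (G : digraph) (w : vertex G * vertex G) : nat :=
  \big[minn/#|vertex G|]_(p in routes w) size p.

(* Largest distance over the ordered pairs joined by a path; this is the usual
   diameter when G is strongly connected. *)
Definition diameter (G : digraph) : nat :=
  \max_(w : vertex G * vertex G | routes w != finset.set0) distance w.

Record network (R : realType) := Network {
  graph :> digraph;
  OD : {set vertex graph * vertex graph};
  demand : vertex graph * vertex graph -> R;
  free_time : {ffun edge graph -> R};
  capacity : {ffun edge graph -> R};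
  demand_ge0 : forall w, w \in OD -> 0 <= demand w;
  routes_neq0 : forall w, w \in OD -> routes w != finset.set0;
  free_time_gt0 : forall e, 0 < free_time e;
  capacity_gt0 : forall e, 0 < capacity e }.

Definition dot (R : realType) (I : finType) (u v : {ffun I -> R}) : R :=
  \sum_i u i * v i.

Definition norm2 (R : realType) (I : finType) (u : {ffun I -> R}) : R :=
  Num.sqrt (\sum_i u i ^+ 2).

(* Convex hull of the finite family (a i), i in A. *)
Definition conv_hull (R : realType) (V : lmodType R) (I : finType)
    (A : {set I}) (a : I -> V) : set V :=
  [set v | exists c : I -> R,
    [/\ forall i, i \in A -> 0 <= c i,
        \sum_(i in A) c i = 1
      & v = \sum_(i in A) c i *: a i]].

Section Model.
Context (R : realType) (N : network R).
Implicit Types (t f g : {ffun edge N -> R}) (w : vertex N * vertex N).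

Definition route_time t (p : route N) : R := \sum_(e in p) t e.

(* The infimum is a minimum, [routes w] being finite and nonempty for w in
   [OD N]. *)
Definition OD_time t w : R := inf [set route_time t p | p in [set` routes w]].

Definition total_demand : R := \sum_(w in OD N) demand w.

Definition Phi t : R := - \sum_(w in OD N) demand w * OD_time t w.

Definition incidence (p : route N) : {ffun edge N -> R} :=
  [ffun e => (e \in p)%:R].

Definition shortest_routes t w : {set route N} :=
  [set p in routes w | route_time t p == OD_time t w]%SET.

(* The Minkowski sum of scaled convex hulls. *)
Definition subdiff_Phi t : set {ffun edge N -> R} :=
  [set g | exists v : vertex N * vertex N -> {ffun edge N -> R},
    (forall w, w \in OD N ->
       conv_hull (shortest_routes t w) incidence (v w)) /\
    g = - \sum_(w in OD N) demand w *: v w].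

Definition M : R := Num.sqrt (2 * (diameter N)%:R) * total_demand.

Section BPR.
Variables rho mu : R.

Definition cost (e : edge N) (z : R) : R :=
  free_time N e * (1 + rho * (z / capacity N e) `^ mu^-1).

Definition Psi f : R :=
  \sum_e \int[lebesgue_measure]_(z in `[0, f e]) cost e z.

Definition dom_h : set {ffun edge N -> R} :=
  [set t | forall e, free_time N e <= t e].

(* Only meaningful on [dom_h]; every use of [h] below is restricted to it. *)
Definition h t : R :=
  \sum_e capacity N e
    * ((t e - free_time N e) / (free_time N e * rho)) `^ mu
    * ((t e - free_time N e) / (1 + mu)).

Definition Q t : R := Phi t + h t.

Definition minimizer_on (D : set {ffun edge N -> R})
    (F : {ffun edge N -> R} -> R) t : Prop :=
  D t /\ forall s, D s -> F t <= F s.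

Definition R_tilde : R :=
  Num.sqrt (rho ^+ 2
    * (\sum_e free_time N e ^+ 2 / capacity N e `^ (2 / mu))
    * total_demand `^ (2 / mu)).

Section UGM.
Variable eps : R.

Definition UGM_prox (g tk : {ffun edge N -> R}) (l : R) t : Prop :=
  minimizer_on dom_h
    (fun s => dot g (s - tk) + h s + l / 2 * norm2 (s - tk) ^+ 2) t.

Definition UGM_test (g tk : {ffun edge N -> R}) (l : R) t : Prop :=
  Phi t <= Phi tk + dot g (t - tk) + l / 2 * norm2 (t - tk) ^+ 2 + eps / 2.

(* [UGM_search g tk l l' t]: the inner loop at the point [tk], with chosen
   subgradient [g] and current trial constant [l], terminates by accepting the
   constant [l'] and the point [t]. *)
Inductive UGM_search (g tk : {ffun edge N -> R}) (l : R)
    : R -> {ffun edge N -> R} -> Prop :=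
| UGM_accept t :
    UGM_prox g tk l t -> UGM_test g tk l t -> UGM_search g tk l l t
| UGM_reject s l' t :
    UGM_prox g tk l s -> ~ UGM_test g tk l s ->
    UGM_search g tk (2 * l) l' t -> UGM_search g tk l l' t.

(* [t k], [L k] and [g k] stand for t^k, L_k and the chosen subgradient of Phi
   at t^k. *)
Definition UGM_run (L0 : R) (t g : nat -> {ffun edge N -> R}) (L : nat -> R)
    : Prop :=
  [/\ t 0%N = free_time N,
      L 0%N = L0,
      forall k, subdiff_Phi (t k) (g k)
    & forall k, UGM_search (g k) (t k) (L k / 2) (L k.+1) (t k.+1)].

End UGM.
End BPR.

Definition S_sum (L : nat -> R) (n : nat) : R :=
  \sum_(1 <= k < n.+1) (L k)^-1.

Definition t_hat (t : nat -> {ffun edge N -> R}) (L : nat -> R) (n : nat)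
    : {ffun edge N -> R} :=
  (S_sum L n)^-1 *: \sum_(1 <= k < n.+1) (L k)^-1 *: t k.

Definition f_hat (g : nat -> {ffun edge N -> R}) (L : nat -> R) (n : nat)
    : {ffun edge N -> R} :=
  - ((S_sum L n)^-1 *: \sum_(0 <= k < n) (L k.+1)^-1 *: g k).

End Model.

(* [P] holds after at most [K] iterations, [K] being a real number. *)
Definition holds_within (R : realType) (K : R) (P : nat -> Prop) : Prop :=
  exists n : nat,
    [/\ (1 <= n)%N, n%:Z <= Num.max 1 (Num.ceil K) & P n].

(* Main.v *)
(* Phi is convex and positively homogeneous, so a subgradient g at t satisfies
   <g, s> <= Phi s for every s, with equality at s = t.  A trial constant
   l >= M^2 / eps always passes the test of UGM because
   M |d| <= l/2 |d|^2 + eps/2; hence L_k <= 2 M^2 / eps and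
   S_n >= n eps / (2 M^2).  The strong convexity of the proximal subproblem and
   telescoping give, for every s >= free_time,
     Q(t_hat) <= h(s) - <f_hat, s> + eps/2 + |s - free_time|^2 / (2 S_n).
   With s = tstar the first two terms are at most Q(tstar).  With
   s_e = cost_e(f_hat_e) they equal - Psi(f_hat) by Fenchel duality, and
   0 <= f_hat_e <= sum_w d_w bounds |s - free_time| by R_tilde. *)
Require Import Defs.
From HB Require Import structures.
From mathcomp Require Import all_boot all_order all_algebra.
From mathcomp Require Import all_classical all_reals all_analysis.
From mathcomp Require Import ring lra.

Set Implicit Arguments.
Unset Strict Implicit.
Unset Printing Implicit Defensive.

Import Order.TTheory GRing.Theory Num.Theory.
Import numFieldNormedType.Exports.
Local Open Scope classical_set_scope.
Local Open Scope ring_scope.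

(** * Euclidean geometry and convexity through global subgradients *)

Section Dot.
Context (R : realType) (I : finType).
Implicit Types (u v w : {ffun I -> R}) (a l : R).

Lemma dotC u v : dot u v = dot v u.
Proof. by apply: eq_bigr => i _; rewrite mulrC. Qed.

Lemma dotDr u v w : dot u (v + w) = dot u v + dot u w.
Proof. by rewrite -big_split; apply: eq_bigr => i _; rewrite ffunE mulrDr. Qed.

Lemma dotZr a u v : dot u (a *: v) = a * dot u v.
Proof. by rewrite mulr_sumr; apply: eq_bigr => i _; rewrite ffunE mulrCA. Qed.

Lemma dotNr u v : dot u (- v) = - dot u v.
Proof. by rewrite -scaleN1r dotZr mulN1r. Qed.

Lemma dotBr u v w : dot u (v - w) = dot u v - dot u w.
Proof. by rewrite dotDr dotNr. Qed.

Lemma dot0r u : dot u 0 = 0.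
Proof. by rewrite -(scale0r (0 : {ffun I -> R})) dotZr mul0r. Qed.

Lemma dot_sumr (J : Type) (r : seq J) (P : pred J) u (F : J -> {ffun I -> R}) :
  dot u (\sum_(j <- r | P j) F j) = \sum_(j <- r | P j) dot u (F j).
Proof. exact: (big_morph (dot u) (dotDr u) (dot0r u)). Qed.

Lemma dotZl a u v : dot (a *: u) v = a * dot u v.
Proof. by rewrite dotC dotZr dotC. Qed.

Lemma dotNl u v : dot (- u) v = - dot u v.
Proof. by rewrite dotC dotNr dotC. Qed.

Lemma dotBl u v w : dot (u - v) w = dot u w - dot v w.
Proof. by rewrite dotC dotBr !(dotC w). Qed.

Lemma dot_suml (J : Type) (r : seq J) (P : pred J) (F : J -> {ffun I -> R}) u :
  dot (\sum_(j <- r | P j) F j) u = \sum_(j <- r | P j) dot (F j) u.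
Proof. by rewrite dotC dot_sumr; apply: eq_bigr => j _; rewrite dotC. Qed.

Lemma norm2_ge0 u : 0 <= norm2 u.
Proof. exact: sqrtr_ge0. Qed.

Lemma norm2_sqr u : norm2 u ^+ 2 = \sum_i u i ^+ 2.
Proof. by rewrite sqr_sqrtr// sumr_ge0// => i _; exact: sqr_ge0. Qed.

(** Weighted Young inequality: in each coordinate the gap is a square divided by [2 * l]. *)
Lemma dot_le_norm2 l u v : 0 < l ->
  dot u v <= (2 * l)^-1 * norm2 u ^+ 2 + l / 2 * norm2 v ^+ 2.
Proof.
move=> l0; rewrite !norm2_sqr !mulr_sumr -big_split; apply: ler_sum => i _ /=.
rewrite -subr_ge0.
have -> : (2 * l)^-1 * u i ^+ 2 + l / 2 * v i ^+ 2 - u i * v i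
  = (2 * l)^-1 * (u i - l * v i) ^+ 2.
  by field; rewrite gt_eqF.
by rewrite mulr_ge0 ?sqr_ge0// invr_ge0; lra.
Qed.

(** This exact identity carries the strong convexity of the proximal subproblem. *)
Lemma norm2_sqr_comb a u v :
  norm2 (u + a *: (v - u)) ^+ 2 =
  (1 - a) * norm2 u ^+ 2 + a * norm2 v ^+ 2 - a * (1 - a) * norm2 (v - u) ^+ 2.
Proof.
rewrite !norm2_sqr !mulr_sumr -big_split -sumrB; apply: eq_bigr => i _ /=.
have -> : (u + a *: (v - u)) i = u i + a * (v i - u i) by rewrite !ffunE.
have -> : (v - u) i = v i - u i by rewrite !ffunE.
ring.
Qed.

(* Convexity, stated as the existence of subgradients on the whole of [D]. *)
Definition supported (D : set {ffun I -> R}) (F : {ffun I -> R} -> R) :=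
  forall y, D y -> exists v, forall x, D x -> F y + dot v (x - y) <= F x.

Lemma supportedD D F G :
  supported D F -> supported D G -> supported D (fun x => F x + G x).
Proof.
move=> sF sG y Dy; have [v vF] := sF y Dy; have [w wG] := sG y Dy.
exists (v + w) => x Dx; rewrite dotC dotDr !(dotC (x - y)).
by have := vF x Dx; have := wG x Dx; lra.
Qed.

Lemma supported_dot D u w : supported D (fun x => dot u (x - w)).
Proof. by move=> y _; exists u => x _; rewrite -dotDr addrC subrKA. Qed.

(** The subgradient is taken at the barycentre, where the linear terms average to zero. *)
Lemma supported_jensen D F (J : Type) (r : seq J) (c : J -> R)
    (x : J -> {ffun I -> R}) :
  supported D F -> (forall j, 0 <= c j) -> \sum_(j <- r) c j = 1 ->
  (forall j, D (x j)) -> D (\sum_(j <- r) c j *: x j) ->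
  F (\sum_(j <- r) c j *: x j) <= \sum_(j <- r) c j * F (x j).
Proof.
move=> sF c0 c1 Dx Dy; set y := (\sum_(j <- r) _) in Dy *.
have [v vF] := sF y Dy.
have -> : F y = \sum_(j <- r) c j * (F y + dot v (x j - y)).
  under eq_bigr => j _ do rewrite mulrDr -dotZr scalerBr.
  rewrite big_split /= -mulr_suml c1 mul1r -dot_sumr sumrB -scaler_suml c1.
  by rewrite scale1r subrr dot0r addr0.
by apply: ler_sum => j _; apply: ler_wpM2l; rewrite ?vF.
Qed.

Lemma supported_segment D F a x y :
  supported D F -> 0 <= a <= 1 -> D x -> D y -> D (x + a *: (y - x)) ->
  F (x + a *: (y - x)) <= (1 - a) * F x + a * F y.
Proof.
move=> sF /andP[a0 a1] Dx Dy Dz; have [v vF] := sF _ Dz.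
have := vF x Dx; have := vF y Dy.
rewrite !opprD !addrA subrr sub0r dotNr dotZr.
have -> : y - x - a *: (y - x) = (1 - a) *: (y - x).
  by rewrite scalerBl scale1r.
rewrite dotZr; nra.
Qed.
End Dot.

(** * Three-point inequality for the proximal step *)

Lemma le_limit0 (R : realType) (A B C : R) : 0 <= C ->
  (forall a, 0 < a < 1 -> A <= B - (1 - a) * C) -> A + C <= B.
Proof.
move=> C0 H; apply/ler_addgt0Pr => e e0.
(* This value of [a] makes the error [a * C] at most [e]; the summand 1 keeps it below 1 even when
   [C] is 0. *)
have a0 : 0 < e / (e + C + 1) < 1.
  by rewrite divr_gt0 ?ltr_pdivrMr; lra.
have := H _ a0; have : e / (e + C + 1) * C <= e.
  by rewrite mulrAC ler_pdivrMr; nra.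
lra.
Qed.

(** The minimizer [t] is compared with [t + a *: (s - t)]. After expanding the squared norm and
    cancelling a factor [a], the gap contains [(1 - a) * (l / 2 * norm2 (s - t) ^+ 2)], and [a]
    tends to 0. *)
Lemma prox_three_point (R : realType) (N : network R)
    (D : set {ffun edge N -> R}) F (c t : {ffun edge N -> R}) l :
  supported D F -> 0 <= l ->
  (forall x y a, D x -> D y -> 0 <= a <= 1 -> D (x + a *: (y - x))) ->
  minimizer_on D (fun s => F s + l / 2 * norm2 (s - c) ^+ 2) t ->
  forall s, D s ->
    F t + l / 2 * norm2 (t - c) ^+ 2 + l / 2 * norm2 (s - t) ^+ 2
    <= F s + l / 2 * norm2 (s - c) ^+ 2.
Proof.
move=> sF l0 Dconv [Dt tmin] s Ds.
have st : s - c - (t - c) = s - t by rewrite opprB addrA subrK.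
apply: le_limit0 => [|a /andP[a0 a1]]; first by rewrite mulr_ge0 ?sqr_ge0; lra.
have a01 : 0 <= a <= 1 by rewrite !ltW.
have Dz := Dconv _ _ _ Dt Ds a01.
have := tmin _ Dz; have := supported_segment sF a01 Dt Ds Dz.
have := norm2_sqr_comb a (t - c) (s - c); rewrite st addrAC => -> Fz tz.
rewrite -(ler_pM2l a0); nra.
Qed.

(** * Subgradients of the shortest-path function [Phi] *)

Section Phi.
Context (R : realType) (N : network R).
Implicit Types (t s g v : {ffun edge N -> R}) (w : vertex N * vertex N).

Lemma dot_incidence t (p : route N) : dot (incidence p) t = route_time t p.
Proof.
rewrite /route_time big_mkcond /=; apply: eq_bigr => e _.
by rewrite ffunE; case: (e \in p); rewrite ?mul1r ?mul0r.
Qed.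

Lemma OD_time_attained t w : w \in OD N ->
  exists2 p, p \in routes w &
    OD_time t w = route_time t p /\
    forall q, q \in routes w -> OD_time t w <= route_time t q.
Proof.
move=> /routes_neq0 /finset.set0Pn[p0 p0w].
case: (@arg_minP _ _ _ p0 (mem (routes w)) (route_time t) p0w) => p pw pmin.
exists p => //.
have lb : lbound [set route_time t p | p in [set` routes w]] (route_time t p).
  by move=> _ [q /= qw <-]; exact: pmin.
have -> : OD_time t w = route_time t p; last by split.
apply/eqP; rewrite eq_le; apply/andP; split.
  by apply: ge_inf; [exists (route_time t p) | exists p].
by apply: lb_le_inf => //; exists (route_time t p); exists p.
Qed.

Lemma OD_time_le t w (p : route N) :
  w \in OD N -> p \in routes w -> OD_time t w <= route_time t p.
Proof. by move=> /(OD_time_attained t)[q _ [_ le]] /le. Qed.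

(** Pairing with [t] averages times that all equal the minimum; pairing with another [s] averages
    times that are at least the minimum at [s]. *)
Lemma conv_hull_shortest_dot t w v :
  conv_hull (shortest_routes t w) (@incidence R N) v ->
  w \in OD N -> dot v t = OD_time t w /\ forall s, OD_time s w <= dot v s.
Proof.
move=> [c [c0 c1 ->]] wOD; split => [|s].
  rewrite dot_suml -[RHS]mul1r -c1 mulr_suml; apply: eq_bigr => p.
  by rewrite inE => /andP[_ /eqP <-]; rewrite dotZl dot_incidence.
rewrite dot_suml -[leLHS]mul1r -c1 mulr_suml; apply: ler_sum => p ps.
rewrite dotZl dot_incidence ler_wpM2l ?c0//.
by move: ps; rewrite inE => /andP[/(OD_time_le s wOD)].
Qed.

(** Euler's identity for a function homogeneous of degree one. *)
Lemma subdiff_Phi_dot t g : subdiff_Phi t g -> dot g t = Phi t.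
Proof.
move=> [v [vw ->]]; rewrite dotNl dot_suml; congr (- _).
by apply: eq_bigr => w wOD;
  rewrite dotZl (conv_hull_shortest_dot (vw w wOD) wOD).1.
Qed.

(* [Phi] is positively homogeneous, so its subgradients minorize it linearly. *)
Lemma subdiff_Phi_le t g s : subdiff_Phi t g -> dot g s <= Phi s.
Proof.
move=> [v [vw ->]]; rewrite dotNl dot_suml lerN2; apply: ler_sum => w wOD.
rewrite dotZl ler_wpM2l ?demand_ge0//.
exact: (conv_hull_shortest_dot (vw w wOD) wOD).2.
Qed.

Lemma subdiff_Phi_ex t : exists g, subdiff_Phi t g.
Proof.
have /choice[v vP] : forall w, exists v, w \in OD N ->
    conv_hull (shortest_routes t w) (@incidence R N) v.
  move=> w; have [wOD|] := boolP (w \in OD N); last by exists 0.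
  have [p pw [pE _]] := OD_time_attained t wOD.
  (* All the weight goes to a single shortest route. *)
  exists (incidence p) => _; exists (fun q => (q == p)%:R).
  have pS : p \in shortest_routes t w by rewrite inE pw pE/=.
  split=> [q _||]; first exact: ler0n.
    rewrite (bigD1 p)//= eqxx big1 ?addr0// => q /andP[_ /negPf->]//.
  rewrite (bigD1 p)//= eqxx scale1r big1 ?addr0// => q.
  by move=> /andP[_ /negPf->]; rewrite scale0r.
by exists (- \sum_(w in OD N) demand w *: v w); exists v.
Qed.

Lemma supported_Phi (D : set {ffun edge N -> R}) : supported D (@Phi R N).
Proof.
move=> y _; have [g gy] := subdiff_Phi_ex y; exists g => x _.
by rewrite dotBr (subdiff_Phi_dot gy) addrC subrK (subdiff_Phi_le _ gy).
Qed.

Lemma total_demand_ge0 : 0 <= total_demand N.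
Proof. by apply: sumr_ge0 => w; exact: demand_ge0. Qed.

(** Convex combinations of 0/1 vectors have entries between 0 and 1, so no edge carries more than
    the whole demand. *)
Lemma subdiff_Phi_bounds t g e :
  subdiff_Phi t g -> 0 <= - g e <= total_demand N.
Proof.
move=> [v [vw ->]]; rewrite !ffunE opprK sum_ffunE.
have vb w : w \in OD N -> 0 <= v w e <= 1.
  move=> /vw[c [c0 c1 ->]]; rewrite sum_ffunE; apply/andP; split.
    by apply: sumr_ge0 => p /c0 cp; rewrite !ffunE mulr_ge0.
  rewrite -c1; apply: ler_sum => p /c0 cp; rewrite !ffunE.
  by rewrite ler_piMr// lern1 leq_b1.
apply/andP; split.
  apply: sumr_ge0 => w wOD; rewrite ffunE.
  by rewrite mulr_ge0 ?demand_ge0//; case/andP: (vb w wOD).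
apply: ler_sum => w wOD; rewrite ffunE.
by rewrite ler_piMr ?demand_ge0//; case/andP: (vb w wOD).
Qed.

(** With [g'] a subgradient at [s], the linearization error is at most [dot (g' - g) (s - t)].
    Young's inequality splits it into the quadratic term of the test and at most
    [M N ^+ 2 / (2 * l)], hence at most [eps / 2]. *)
Lemma Phi_descent eps t s g l : subdiff_Phi t g ->
    (forall g', subdiff_Phi s g' -> norm2 (g' - g) <= M N) ->
  0 < eps -> 0 < l -> M N ^+ 2 / eps <= l -> UGM_test eps g t l s.
Proof.
move=> gt gM eps0 l0 Ml; have [g' gs] := subdiff_Phi_ex s.
rewrite /UGM_test -(subdiff_Phi_dot gt) dotBr -(subdiff_Phi_dot gs).
have H := dot_le_norm2 (g' - g) (s - t) l0.
have tg := subdiff_Phi_le t gs; rewrite -(subdiff_Phi_dot gt) in tg.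
have n0 := norm2_ge0 (g' - g).
have : (2 * l)^-1 * norm2 (g' - g) ^+ 2 <= eps / 2.
  rewrite mulrC ler_pdivrMr; last by lra.
  have := gM _ gs; move: Ml; rewrite ler_pdivrMr//; nra.
move: H; rewrite dotBl !dotBr; lra.
Qed.
End Phi.

(** * Real powers: tangent inequality and integration *)

Section PowR.
Context (R : realType).
Implicit Types p a b c x y : R.

(* Young's inequality for [x] and [y `^ p], with exponents [1 + p] and
   [(1 + p) / p]. *)
Lemma powR_tangent p x y : 0 < p -> 0 <= x -> 0 <= y ->
  y `^ p * (y / (1 + p)) + y `^ p * (x - y) <= x `^ p * (x / (1 + p)).
Proof.
move=> p0 x0 y0; have p1 : 0 < 1 + p by lra.
have powS z : 0 <= z -> z `^ p * z = z `^ (1 + p).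
  move=> z0; have := mulr_powRB1 z0 p1; rewrite mulrC => <-.
  by congr (_ `^ _ * _); ring.
have := @conjugate_powR R x (y `^ p) (1 + p) ((1 + p) / p) x0 (powR_ge0 _ _) p1.
rewrite -powRrM mulrCA divff ?gt_eqF// mulr1 -!powS//.
move=> /(_ (divr_gt0 p1 p0)).
have -> : (1 + p)^-1 + ((1 + p) / p)^-1 = 1 by field; rewrite !gt_eqF.
move=> /(_ erefl).
have -> : y `^ p * y / ((1 + p) / p) = y `^ p * y - y `^ p * y / (1 + p).
  by field; rewrite !gt_eqF.
by rewrite !mulrA mulrBr; lra.
Qed.

Lemma continuous_powR_gt0 p x : 0 < x -> {for x, continuous (@powR R ^~ p)}.
Proof.
move=> x0; apply: differentiable_continuous; apply/derivable1_diffP.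
by apply: derivable_powR; rewrite in_itv/= x0.
Qed.

Lemma powR_cvg_right0 p : 0 < p -> @powR R ^~ p @ 0^'+ --> (0 : R) `^ p.
Proof. by move=> p0; rewrite powR0 ?gt_eqF//; exact: powR_cvg0. Qed.

(** Fundamental theorem of calculus for the primitive [F], differentiated only at positive points;
    the end point 0 is reached by a one-sided limit, and [b = 0] is treated apart. *)
Lemma Rintegral_affine_powR a c p b : 0 < p -> 0 <= b ->
  \int[lebesgue_measure]_(z in `[0, b]) (a + c * z `^ p) =
  a * b + c / (1 + p) * b `^ (1 + p).
Proof.
move=> p0; have p1 : 0 < 1 + p by lra.
rewrite le_eqVlt => /predU1P[<-|b0].
  by rewrite set_itv1 Rintegral_set1 powR0 ?gt_eqF//; ring.
pose F z := a * z + c / (1 + p) * z `^ (1 + p).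
have dF x : 0 < x -> is_derive x 1 F (a + c * x `^ p).
  move=> x0; have := is_derive1_powR (1 + p) x0 => dp.
  apply: is_derive_eq; rewrite /GRing.scale/= mulr1.
  rewrite (_ : 1 + p - 1 = p); last by ring.
  by rewrite mulrA divfK// gt_eqF.
rewrite /Rintegral (@continuous_FTC2 _ _ F)//.
- by rewrite /F powR0 ?gt_eqF//= !mulr0 addr0 subr0.
- apply/continuous_within_itvP => //; split.
  + move=> x; rewrite in_itv/= => /andP[x0 _].
    by apply: cvgD; [exact: cvg_cst|apply: cvgM; [exact: cvg_cst|
      exact: continuous_powR_gt0]].
  + by apply: cvgD; [exact: cvg_cst|apply: cvgM; [exact: cvg_cst|
      exact: powR_cvg_right0]].
  + apply: cvg_at_left_filter; apply: cvgD; [exact: cvg_cst|apply: cvgM;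
      [exact: cvg_cst|exact: continuous_powR_gt0]].
- split.
  + by move=> x; rewrite in_itv/= => /andP[x0 _]; have [] := dF x x0.
  + apply: cvgD; apply: cvgM; [exact: cvg_cst| |exact: cvg_cst|].
      by apply: cvg_at_right_filter; exact: cvg_id.
    exact: powR_cvg_right0.
  + apply: cvg_at_left_filter; apply: cvgD; apply: cvgM;
      [exact: cvg_cst|exact: cvg_id|exact: cvg_cst|].
    exact: continuous_powR_gt0.
- move=> x; rewrite in_itv/= => /andP[x0 _]; rewrite derive1E.
  by have [] := dF x x0.
Qed.
End PowR.

(** * The function [h], its conjugate [Psi], and the BPR costs *)

Section Cost.
Context (R : realType) (N : network R) (rho mu : R).
Hypotheses (rho_gt0 : 0 < rho) (mu_gt0 : 0 < mu).
Implicit Types (t s f v : {ffun edge N -> R}).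

Lemma dom_h_ge0 t e : dom_h t -> 0 <= t e.
Proof. by move=> /(_ e); apply: le_trans; exact/ltW/free_time_gt0. Qed.

Lemma dom_h_segment t s a :
  dom_h t -> dom_h s -> 0 <= a <= 1 -> dom_h (t + a *: (s - t)).
Proof.
move=> td sd /andP[a0 a1] e; have := td e; have := sd e.
have -> : (t + a *: (s - t)) e = t e + a * (s e - t e) by rewrite !ffunE.
nra.
Qed.

Lemma dom_h_comb (J : Type) (r : seq J) (c : J -> R)
    (x : J -> {ffun edge N -> R}) :
  (forall j, 0 <= c j) -> \sum_(j <- r) c j = 1 -> (forall j, dom_h (x j)) ->
  dom_h (\sum_(j <- r) c j *: x j).
Proof.
move=> c0 c1 xd e; rewrite sum_ffunE -[leLHS]mul1r -c1 mulr_suml.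
by apply: ler_sum => j _; rewrite ffunE ler_wpM2l ?xd.
Qed.

Lemma supported_h : supported (@dom_h R N) (h rho mu).
Proof.
move=> y yd.
pose z (x : {ffun edge N -> R}) e :=
  (x e - free_time N e) / (free_time N e * rho).
exists [ffun e => capacity N e * z y e `^ mu] => x xd.
rewrite /h /dot -big_split; apply: ler_sum => e _ /=; rewrite !ffunE.
have t0 := free_time_gt0 e.
have tr0 : 0 < free_time N e * rho by rewrite mulr_gt0.
have c0 := capacity_gt0 e.
have z0 w : dom_h w -> 0 <= z w e.
  by move=> /(_ e) wd; rewrite divr_ge0 ?subr_ge0// ltW.
have E (w : {ffun edge N -> R}) :
    w e - free_time N e = free_time N e * rho * z w e.
  by rewrite mulrC divfK ?gt_eqF.
have T := powR_tangent mu_gt0 (z0 x xd) (z0 y yd).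
rewrite -(ler_pM2l c0) -(ler_pM2l tr0) in T.
have -> : x e - y e = free_time N e * rho * (z x e - z y e).
  by rewrite mulrBr -!E; ring.
rewrite -!/(z _ e) !E; lra.
Qed.

(* [Psi] is the conjugate of [h], the supremum being attained at [cost f]. *)
Lemma Psi_conj f : (forall e, 0 <= f e) ->
  Psi rho mu f = dot f [ffun e => cost rho mu e (f e)]
    - h rho mu [ffun e => cost rho mu e (f e)].
Proof.
move=> f0; rewrite -sumrB; apply: eq_bigr => e _; rewrite !ffunE.
set tb : R := free_time N e; set fb : R := capacity N e.
have t0 : 0 < tb := free_time_gt0 e; have c0 : 0 < fb := capacity_gt0 e.
have m0 : 0 < mu^-1 by rewrite invr_gt0.
have split_cost (z : R) : 0 <= z ->
    cost rho mu e z = tb + tb * rho * fb^-1 `^ mu^-1 * z `^ mu^-1.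
  move=> z0; rewrite /cost powRM ?invr_ge0 ?(ltW c0)// -/tb -/fb; ring.
have -> : \int[lebesgue_measure]_(z in `[0, f e]) cost rho mu e z =
    \int[lebesgue_measure]_(z in `[0, f e])
      (tb + tb * rho * fb^-1 `^ mu^-1 * z `^ mu^-1).
  apply: eq_Rintegral => z.
  by rewrite inE/= in_itv/= => /andP[z0 _]; exact: split_cost.
rewrite Rintegral_affine_powR// split_cost// addrAC subrr add0r.
set k := fb^-1 `^ mu^-1; set u := f e `^ mu^-1.
(* Here [k * u] is the power [mu^-1] of [f e / fb], so raising it to [mu] recovers [f e / fb]: the
   cost function is inverted. *)
have -> : tb * rho * k * u / (tb * rho) = k * u.
  by field; rewrite !gt_eqF.
have -> : (k * u) `^ mu = fb^-1 * f e.
  rewrite -powRM ?invr_ge0 ?(ltW c0)// -powRrM mulVf ?gt_eqF//.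
  by rewrite powRr1 ?mulr_ge0 ?invr_ge0 ?(ltW c0).
have -> : f e `^ (1 + mu^-1) = f e * u.
  rewrite -(@mulr_powRB1 _ (f e) (1 + mu^-1))//; last by lra.
  by congr (_ * _ `^ _); ring.
have m1 : 0 < 1 + mu by rewrite addr_gt0.
by field; rewrite !gt_eqF.
Qed.

Lemma cost_dom_h f : dom_h [ffun e => cost rho mu e (f e)].
Proof.
move=> e; rewrite ffunE /cost ler_peMr//; first exact/ltW/free_time_gt0.
by rewrite lerDl mulr_ge0 ?powR_ge0// ltW.
Qed.

(** The excess of the cost over the free time increases with the flow; putting the total demand in
    place of each [f e] gives the summands of [R_tilde]. *)
Lemma cost_radius f : (forall e, 0 <= f e <= total_demand N) ->
  norm2 ([ffun e => cost rho mu e (f e)] - free_time N) ^+ 2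
    <= R_tilde N rho mu ^+ 2.
Proof.
move=> fb; rewrite norm2_sqr /R_tilde sqr_sqrtr; last first.
  rewrite mulr_ge0 ?powR_ge0// mulr_ge0 ?sqr_ge0//; apply: sumr_ge0 => e _.
  by rewrite mulr_ge0 ?sqr_ge0// invr_ge0 powR_ge0.
rewrite mulrAC mulr_sumr; apply: ler_sum => e _; rewrite !ffunE.
have /andP[f0 fd] := fb e.
have c0 : 0 < capacity N e := capacity_gt0 e.
have -> : cost rho mu e (f e) - free_time N e
    = free_time N e * rho * (f e / capacity N e) `^ mu^-1.
  by rewrite /cost; ring.
have -> : (free_time N e * rho * (f e / capacity N e) `^ mu^-1) ^+ 2
    = free_time N e ^+ 2 * rho ^+ 2
      * (f e `^ (2 / mu) / capacity N e `^ (2 / mu)).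
  rewrite !exprMn -[(_ `^ _) ^+ 2]powR_mulrn ?powR_ge0// -powRrM.
  rewrite [mu^-1 * _]mulrC.
  rewrite powRM ?invr_ge0 ?(ltW c0)//; congr (_ * (_ * _)).
  by rewrite -powR_inv1 ?(ltW c0)// -powRrM mulN1r powRN.
have le : f e `^ (2 / mu) <= total_demand N `^ (2 / mu).
  by apply: ge0_ler_powR => //; rewrite ?nnegrE ?total_demand_ge0//
    divr_ge0// ltW.
have k0 : 0 <= (capacity N e `^ (2 / mu))^-1 by rewrite invr_ge0 powR_ge0.
have : 0 <= (capacity N e `^ (2 / mu))^-1 * (free_time N e ^+ 2 * rho ^+ 2).
  by rewrite mulr_ge0// mulr_ge0 ?sqr_ge0.
nra.
Qed.
End Cost.

(** * Analysis of a run of UGM *)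

Section Run.
Context (R : realType) (N : network R) (rho mu : R).
Hypotheses (rho_gt0 : 0 < rho) (mu_gt0 : 0 < mu).
Hypothesis M_bound : forall t1 t2 g1 g2 : {ffun edge N -> R},
  (forall e, 0 <= t1 e) -> (forall e, 0 <= t2 e) ->
  subdiff_Phi t1 g1 -> subdiff_Phi t2 g2 -> norm2 (g1 - g2) <= M N.
Variables (eps L0 : R) (t g : nat -> {ffun edge N -> R}) (L : nat -> R).
Hypotheses (eps_gt0 : 0 < eps) (L0_gt0 : 0 < L0) (L0_le : L0 <= M N ^+ 2 / eps).
Hypothesis run : UGM_run rho mu eps L0 t g L.

(* A trial constant above [M ^ 2 / eps] is never rejected. *)
Lemma UGM_search_spec (c x y : {ffun edge N -> R}) l l' :
  dom_h x -> subdiff_Phi x c -> 0 < l <= 2 * (M N ^+ 2 / eps) ->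
  UGM_search rho mu eps c x l l' y ->
  [/\ UGM_prox rho mu c x l' y, UGM_test eps c x l' y
    & 0 < l' <= 2 * (M N ^+ 2 / eps)].
Proof.
move=> dx cx + S.
elim: S => [{}l {}y prox test lb|{}l s {}l' {}y prox Ntest _ IH lb].
  by [].
apply: IH; case/andP: lb => l0 _; apply/andP; split; first by rewrite mulr_gt0.
(* A rejected [l] lies below [M N ^+ 2 / eps], so its double still satisfies the bound. *)
rewrite ler_pM2l// leNgt; apply/negP => /ltW lM; apply: Ntest.
apply: Phi_descent => // g' gs; apply: M_bound gs cx => e;
  last exact: dom_h_ge0.
by apply: dom_h_ge0; case: prox.
Qed.

(** Halving an accepted constant preserves the bound under which the next search starts; [L0_le]
    provides it for the first search. *)
Lemma UGM_run_spec k :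
  [/\ dom_h (t k), UGM_prox rho mu (g k) (t k) (L k.+1) (t k.+1),
      UGM_test eps (g k) (t k) (L k.+1) (t k.+1)
    & 0 < L k.+1 <= 2 * (M N ^+ 2 / eps)].
Proof.
have [t0 L0E gs search] := run.
have M0 : 0 <= M N ^+ 2 / eps by rewrite divr_ge0 ?sqr_ge0 ?ltW.
have half x :
    0 < x <= 2 * (M N ^+ 2 / eps) -> 0 < x / 2 <= 2 * (M N ^+ 2 / eps).
  by lra.
elim: k => [|k [_ prox _ Lk]].
  have dt : dom_h (t 0%N) by move=> e; rewrite t0.
  have L1 : 0 < L 0%N <= 2 * (M N ^+ 2 / eps) 
    by rewrite L0E L0_gt0 (le_trans L0_le)// ler_peMl// ler1n.
  by have [? ? ?] := UGM_search_spec dt (gs 0%N) (half _ L1) (search 0%N).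
have dt : dom_h (t k.+1) by case: prox.
by have [? ? ?] := UGM_search_spec dt (gs k.+1) (half _ Lk) (search k.+1).
Qed.

(** The test and the three-point inequality are added: the terms in [t k.+1 - t k] cancel, and
    [Phi (t k)] becomes [dot (g k) (t k)]. Dividing by [L k.+1] frees the squared distances from the
    step constant, so that they telescope. *)
Lemma UGM_step k s : dom_h s ->
  (L k.+1)^-1 * Q rho mu (t k.+1) <=
  (L k.+1)^-1 * (dot (g k) s + h rho mu s + eps / 2)
  + norm2 (s - t k) ^+ 2 / 2 - norm2 (s - t k.+1) ^+ 2 / 2.
Proof.
move=> ds; have [dt prox test /andP[l0 _]] := UGM_run_spec k.
have [_ _ gs _] := run.
have sF : supported (@dom_h R N) (fun x => dot (g k) (x - t k) + h rho mu x).
  by apply: supportedD; [exact: supported_dot|exact: supported_h].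
have := prox_three_point sF (ltW l0) (@dom_h_segment R N) prox ds.
move: test; rewrite /UGM_test /Q -(subdiff_Phi_dot (gs k)) !dotBr => test three.
have -> : norm2 (s - t k) ^+ 2 / 2
    = (L k.+1)^-1 * (L k.+1 / 2 * norm2 (s - t k) ^+ 2).
  by field; rewrite gt_eqF.
have -> : norm2 (s - t k.+1) ^+ 2 / 2
    = (L k.+1)^-1 * (L k.+1 / 2 * norm2 (s - t k.+1) ^+ 2).
  by field; rewrite gt_eqF.
rewrite -mulrDr -mulrBr ler_pM2l ?invr_gt0//; lra.
Qed.

Lemma UGM_sum n s : dom_h s ->
  \sum_(0 <= k < n) (L k.+1)^-1 * Q rho mu (t k.+1) <=
  \sum_(0 <= k < n) (L k.+1)^-1 * (dot (g k) s + h rho mu s + eps / 2)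
  + norm2 (s - free_time N) ^+ 2 / 2 - norm2 (s - t n) ^+ 2 / 2.
Proof.
move=> ds; elim: n => [|n IH].
  by have [-> _ _ _] := run; rewrite !big_nil; lra.
by rewrite !big_nat_recr//=; have := UGM_step n ds; lra.
Qed.

Lemma S_sum_shift n : S_sum L n = \sum_(0 <= k < n) (L k.+1)^-1.
Proof. by rewrite /S_sum big_add1. Qed.

Lemma S_sum_ge n : n%:R / (2 * (M N ^+ 2 / eps)) <= S_sum L n.
Proof.
rewrite S_sum_shift mulrC mulr_natr -[X in _ *+ X]subn0 -sumr_const_nat.
apply: ler_sum => k _; have [_ _ _ /andP[l0 lM]] := UGM_run_spec k.
by rewrite lef_pV2 ?posrE// (lt_le_trans l0).
Qed.

Lemma S_sum_gt0 n : (0 < n)%N -> 0 < S_sum L n.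
Proof.
move=> n0; apply: lt_le_trans (S_sum_ge n).
(* [M N ^+ 2 / eps] is positive because it dominates [L0]. *)
by rewrite divr_gt0 ?ltr0n// mulr_gt0// (lt_le_trans L0_gt0).
Qed.

(** The common convex weights of both averages, indexed so that [t k.+1] is paired with [g k]. *)
Let weight n k := (S_sum L n)^-1 * (L k.+1)^-1.

Lemma weight_ge0 n k : (0 < n)%N -> 0 <= weight n k.
Proof.
move=> n0; have [_ _ _ /andP[l0 _]] := UGM_run_spec k.
by rewrite mulr_ge0// invr_ge0 ltW ?S_sum_gt0.
Qed.

Lemma weight_sum n : (0 < n)%N -> \sum_(0 <= k < n) weight n k = 1.
Proof.
by move=> n0; rewrite -mulr_sumr -S_sum_shift mulVf// gt_eqF ?S_sum_gt0.
Qed.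

Lemma t_hat_weight n : t_hat t L n = \sum_(0 <= k < n) weight n k *: t k.+1.
Proof.
by rewrite /t_hat big_add1 scaler_sumr; apply: eq_bigr => k _; rewrite scalerA.
Qed.

Lemma f_hat_weight n : f_hat g L n = - \sum_(0 <= k < n) weight n k *: g k.
Proof.
rewrite /f_hat scaler_sumr; congr (- _).
by apply: eq_bigr => k _; rewrite scalerA.
Qed.

Lemma f_hat_bounds n e : (0 < n)%N -> 0 <= f_hat g L n e <= total_demand N.
Proof.
move=> n0; have [_ _ gs _] := run.
have -> : f_hat g L n e = \sum_(0 <= k < n) weight n k * - g k e.
  rewrite f_hat_weight ffunE sum_ffunE -sumrN.
  by apply: eq_bigr => k _; rewrite ffunE mulrN.
have gb k : 0 <= - g k e <= total_demand N := subdiff_Phi_bounds e (gs k).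
apply/andP; split.
  by apply: sumr_ge0 => k _; case/andP: (gb k) => ? _; rewrite mulr_ge0 ?weight_ge0.
rewrite -[leRHS]mul1r -(weight_sum n0) mulr_suml; apply: ler_sum => k _.
by case/andP: (gb k) => _ ?; rewrite ler_wpM2l ?weight_ge0.
Qed.

(** [- f_hat] averages subgradients, each of which is a linear minorant of [Phi]. *)
Lemma f_hat_Phi n s : (0 < n)%N -> - dot (f_hat g L n) s <= Phi s.
Proof.
move=> n0; have [_ _ gs _] := run.
rewrite f_hat_weight dotNl opprK dot_suml -[leRHS]mul1r -(weight_sum n0).
rewrite mulr_suml; apply: ler_sum => k _; rewrite dotZl ler_wpM2l ?weight_ge0//.
exact: subdiff_Phi_le.
Qed.

(** Jensen's inequality for [Q] reduces this to [UGM_sum] divided by [S_sum L n], with the last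
    squared distance dropped. The point [s] stays free because the two claims use different
    choices. *)
Lemma UGM_estimate n s : (0 < n)%N -> dom_h s ->
  Q rho mu (t_hat t L n) <=
  h rho mu s - dot (f_hat g L n) s + eps / 2
  + norm2 (s - free_time N) ^+ 2 / (2 * S_sum L n).
Proof.
move=> n0 ds; have S0 := S_sum_gt0 n0.
have dt k : dom_h (t k.+1) by have [] := UGM_run_spec k.+1.
have w0 k := weight_ge0 k n0; have w1 := weight_sum n0.
have sQ : supported (@dom_h R N) (Q rho mu).
  by apply: supportedD; [exact: supported_Phi|exact: supported_h].
have := supported_jensen sQ w0 w1 dt (dom_h_comb w0 w1 dt).
rewrite -t_hat_weight => /le_trans; apply.
have -> : \sum_(0 <= k < n) weight n k * Q rho mu (t k.+1)
    = (S_sum L n)^-1 * \sum_(0 <= k < n) (L k.+1)^-1 * Q rho mu (t k.+1).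
  by rewrite mulr_sumr; apply: eq_bigr => k _; rewrite mulrA.
have -> : h rho mu s - dot (f_hat g L n) s + eps / 2 = (S_sum L n)^-1 *
    \sum_(0 <= k < n) (L k.+1)^-1 * (dot (g k) s + h rho mu s + eps / 2).
  rewrite f_hat_weight dotNl dot_suml opprK.
  rewrite -[h _ _ _ in LHS]mul1r -[eps / 2 in LHS]mul1r -{1 2}w1.
  rewrite !mulr_suml -!big_split mulr_sumr.
  by apply: eq_bigr => k _ /=; rewrite dotZl /weight; ring.
have -> : norm2 (s - free_time N) ^+ 2 / (2 * S_sum L n)
    = (S_sum L n)^-1 * (norm2 (s - free_time N) ^+ 2 / 2).
  by field; rewrite gt_eqF.
rewrite -mulrDr ler_pM2l ?invr_gt0//.
apply: le_trans (UGM_sum n ds) _; have := sqr_ge0 (norm2 (s - t n)); lra.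
Qed.

(** The threshold equals [r ^+ 2 / eps] times [2 * (M N ^+ 2 / eps)], so [S_sum_ge] yields
    [r ^+ 2 / eps <= S_sum L n]. *)
Lemma radius_le n r : (0 < n)%N -> 2 * (r * M N / eps) ^+ 2 <= n%:R ->
  r ^+ 2 / (2 * S_sum L n) <= eps / 2.
Proof.
move=> n0 rn; have S0 := S_sum_gt0 n0; have := S_sum_ge n.
have M0 : 0 < 2 * (M N ^+ 2 / eps) by rewrite mulr_gt0// (lt_le_trans L0_gt0).
rewrite ler_pdivrMr// => Sn.
have : 2 * (r * M N / eps) ^+ 2 = r ^+ 2 / eps * (2 * (M N ^+ 2 / eps)).
  by field; rewrite gt_eqF.
move=> E; rewrite E in rn.
have := le_trans rn Sn; rewrite ler_pM2r// ler_pdivrMr// => rS.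
by rewrite ler_pdivrMr; nra.
Qed.
End Run.

(** * Iteration counts and conclusion *)

Lemma holds_within_ceil (R : realType) (K : R) (P : nat -> Prop) :
  (forall n, (0 < n)%N -> K <= n%:R -> P n) -> holds_within K P.
Proof.
move=> KP; set m := Num.max 1 (Num.ceil K).
have m1 : 1 <= m by rewrite le_max lexx.
have mE : `|m|%N%:Z = m by rewrite gez0_abs// (le_trans _ m1).
exists `|m|%N; split; first by rewrite -lez_nat mE.
  by rewrite mE.
apply: KP; first by rewrite -ltz_nat mE (lt_le_trans _ m1).
by rewrite pmulrn mE (le_trans (ceil_ge K))// ler_int le_max lexx orbT.
Qed.

Theorem theorem3p4 (R : realType) (N : network R) (rho mu : R)
    (rho_gt0 : 0 < rho) (mu_gt0 : 0 < mu)
    (M_bound : forall t1 t2 g1 g2 : {ffun edge N -> R},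
       (forall e, 0 <= t1 e) -> (forall e, 0 <= t2 e) ->
       subdiff_Phi t1 g1 -> subdiff_Phi t2 g2 ->
       norm2 (g1 - g2) <= M N)
    (tstar : {ffun edge N -> R})
    (tstar_min : minimizer_on (@dom_h R N) (Q rho mu) tstar)
    (eps L0 : R) (eps_gt0 : 0 < eps)
    (L0_gt0 : 0 < L0) (L0_le : L0 <= M N ^+ 2 / eps)
    (t g : nat -> {ffun edge N -> R}) (L : nat -> R)
    (run : UGM_run rho mu eps L0 t g L) :
  holds_within (2 * (norm2 (tstar - free_time N) * M N / eps) ^+ 2)
    (fun n => Q rho mu (t_hat t L n) - Q rho mu tstar <= eps) /\
  holds_within (2 * (R_tilde N rho mu * M N / eps) ^+ 2)
    (fun n => Q rho mu (t_hat t L n) + Psi rho mu (f_hat g L n) <= eps).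
Proof.
have [dstar _] := tstar_min.
have est := UGM_estimate rho_gt0 mu_gt0 M_bound eps_gt0 L0_gt0 L0_le run.
have rad := radius_le M_bound eps_gt0 L0_gt0 L0_le run.
split; apply: holds_within_ceil => n n0 nK.
  (* This bounds [h tstar - dot f_hat tstar] by [Q tstar]; the two remaining terms are at most
     [eps / 2] each. *)
  have fstar := f_hat_Phi M_bound eps_gt0 L0_gt0 L0_le run tstar n0.
  have := est n _ n0 dstar; have := rad n _ n0 nK; rewrite /Q; lra.
have fb e := f_hat_bounds M_bound eps_gt0 L0_gt0 L0_le run e n0.
have f0 e : 0 <= f_hat g L n e by case/andP: (fb e).
rewrite (Psi_conj rho_gt0 mu_gt0 f0).
(* The free point is now the cost vector at [f_hat], at which the conjugacy of [h] and [Psi] is an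
   equality, so [Psi] cancels. *)
have := est n _ n0 (cost_dom_h mu rho_gt0 (f_hat g L n)).
have := cost_radius rho mu_gt0 fb.
have S0 := S_sum_gt0 M_bound eps_gt0 L0_gt0 L0_le run n0.
set s := [ffun e => _]; move=> cr.
have : norm2 (s - free_time N) ^+ 2 / (2 * S_sum L n)
    <= R_tilde N rho mu ^+ 2 / (2 * S_sum L n).
  by rewrite ler_pM2r// invr_gt0 mulr_gt0.
have := rad n _ n0 nK; lra.
Qed.
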